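(* Let $a_x>a_y>a_z>0$ be real numbers and let $P_G=(X_G,Y_G,Z_G)\neq(0,0,0)$ be a point of $\mathbb{R}^3$ with $X_G,Y_G\ge 0$ and $Z_G>0$. Let $$A(t)=(t+a_x^2)^2(t+a_y^2)^2(t+a_z^2)^2-a_x^2X_G^2(t+a_y^2)^2(t+a_z^2)^2-a_y^2Y_G^2(t+a_x^2)^2(t+a_z^2)^2-a_z^2Z_G^2(t+a_x^2)^2(t+a_y^2)^2 .$$ If $P_G$ is situated inside the reference ellipsoid, then the polynomial $A(t)$ has a unique real root satisfying $-a_z^2<t<0$.
   Context: The reference ellipsoid is the triaxial ellipsoid $\frac{X^2}{a_x^2}+\frac{Y^2}{a_y^2}+\frac{Z^2}{a_z^2}=1$. The point $P_G$ is inside the reference ellipsoid if $\frac{X_G^2}{a_x^2}+\frac{Y_G^2}{a_y^2}+\frac{Z_G^2}{a_z^2}<1$. The monic sixth degree polynomial $A(t)$ is (up to sign) the numerator of $\frac{a_x^2X_G^2}{(t+a_x^2)^2}+\frac{a_y^2Y_G^2}{(t+a_y^2)^2}+\frac{a_z^2Z_G^2}{(t+a_z^2)^2}-1$ over the common denominator $(t+a_x^2)^2(t+a_y^2)^2(t+a_z^2)^2$. *)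

(* Defs.v *)
From mathcomp Require Import all_boot all_order all_algebra.
From mathcomp Require Import reals.

Set Implicit Arguments.
Unset Strict Implicit.
Unset Printing Implicit Defensive.

Import Order.TTheory GRing.Theory Num.Theory.
Local Open Scope ring_scope.

Definition inside_ellipsoid (R : realType) (ax ay az XG YG ZG : R) : Prop :=
  XG ^+ 2 / ax ^+ 2 + YG ^+ 2 / ay ^+ 2 + ZG ^+ 2 / az ^+ 2 < 1.

(* The opposite of the numerator of
     ax^2 XG^2 / (t + ax^2)^2 + ay^2 YG^2 / (t + ay^2)^2
       + az^2 ZG^2 / (t + az^2)^2 - 1
   over the common denominator (t + ax^2)^2 (t + ay^2)^2 (t + az^2)^2. *)
Definition polyA (R : realType) (ax ay az XG YG ZG : R) : {poly R} :=
  ('X + (ax ^+ 2)%:P) ^+ 2 * ('X + (ay ^+ 2)%:P) ^+ 2 * ('X + (az ^+ 2)%:P) ^+ 2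
  - (ax ^+ 2 * XG ^+ 2) *: (('X + (ay ^+ 2)%:P) ^+ 2 * ('X + (az ^+ 2)%:P) ^+ 2)
  - (ay ^+ 2 * YG ^+ 2) *: (('X + (ax ^+ 2)%:P) ^+ 2 * ('X + (az ^+ 2)%:P) ^+ 2)
  - (az ^+ 2 * ZG ^+ 2) *: (('X + (ax ^+ 2)%:P) ^+ 2 * ('X + (ay ^+ 2)%:P) ^+ 2).

(* Main.v *)
Require Import Defs.
From mathcomp Require Import all_boot all_order all_algebra.
From mathcomp Require Import reals.
From mathcomp Require Import ring lra.

Import Order.TTheory GRing.Theory Num.Theory.
Local Open Scope ring_scope.

(** Write [secular t] for
      [ax^2 XG^2 / (t + ax^2)^2 + ay^2 YG^2 / (t + ay^2)^2
       + az^2 ZG^2 / (t + az^2)^2].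
    Its largest pole is [- az ^+ 2], and to the right of it the polynomial [A]
    is a positive factor times [1 - secular t] ([horner_polyA_secular]).  So the
    roots of [A] there are the solutions of [secular t = 1].  To the right of
    all the poles no summand increases with [t], and the last one decreases
    strictly since [ZG] is positive; hence the sum is strictly decreasing
    ([secular_decreasing]) and there is at most one root.

    Existence is the intermediate value theorem on [[- az ^+ 2, 0]]: at the left
    end only the term of [A] without the factor [(t + az ^+ 2) ^+ 2] survives,
    and it is negative; [secular 0] is exactly the left-hand side of the
    inequality saying that the point is inside the ellipsoid ([secular0]), so
    that [A] is positive at [0]. *)

(** The point of coordinates [ax^2 XG / (t + ax^2)], [ay^2 YG / (t + ay^2)],
    [az^2 ZG / (t + az^2)], critical for the distance to [(XG, YG, ZG)] with
    Lagrange multiplier [t], lies on the ellipsoid when [secular t = 1]. *)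
Definition secular {R : realType} (ax ay az XG YG ZG t : R) : R :=
  ax ^+ 2 * XG ^+ 2 / (t + ax ^+ 2) ^+ 2
  + ay ^+ 2 * YG ^+ 2 / (t + ay ^+ 2) ^+ 2
  + az ^+ 2 * ZG ^+ 2 / (t + az ^+ 2) ^+ 2.

Lemma horner_polyA (R : realType) (ax ay az XG YG ZG t : R) :
  (polyA ax ay az XG YG ZG).[t] =
  (t + ax ^+ 2) ^+ 2 * (t + ay ^+ 2) ^+ 2 * (t + az ^+ 2) ^+ 2
  - ax ^+ 2 * XG ^+ 2 * ((t + ay ^+ 2) ^+ 2 * (t + az ^+ 2) ^+ 2)
  - ay ^+ 2 * YG ^+ 2 * ((t + ax ^+ 2) ^+ 2 * (t + az ^+ 2) ^+ 2)
  - az ^+ 2 * ZG ^+ 2 * ((t + ax ^+ 2) ^+ 2 * (t + ay ^+ 2) ^+ 2).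
Proof. by rewrite /polyA !hornerE. Qed.

Lemma horner_polyA_secular (R : realType) (ax ay az XG YG ZG t : R) :
  t + ax ^+ 2 != 0 -> t + ay ^+ 2 != 0 -> t + az ^+ 2 != 0 ->
  (polyA ax ay az XG YG ZG).[t] =
  ((t + ax ^+ 2) * (t + ay ^+ 2) * (t + az ^+ 2)) ^+ 2
  * (1 - secular ax ay az XG YG ZG t).
Proof.
move=> nx ny nz; rewrite horner_polyA /secular.
by field; rewrite nx ny nz.
Qed.

Lemma ltr_pinv_sqr (R : realType) (d s t : R) :
  0 < s + d -> s < t -> ((t + d) ^+ 2)^-1 < ((s + d) ^+ 2)^-1.
Proof.
move=> sd st; have td : 0 < t + d by lra.
rewrite ltf_pV2 ?posrE ?exprn_gt0 // ltrXn2r ?nnegrE ?ltW //.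
by rewrite ltrD2r.
Qed.

Lemma secular_decreasing (R : realType) (ax ay az XG YG ZG s t : R) :
  0 < s + ax ^+ 2 -> 0 < s + ay ^+ 2 -> 0 < s + az ^+ 2 ->
  0 < az -> 0 < ZG -> s < t ->
  secular ax ay az XG YG ZG t < secular ax ay az XG YG ZG s.
Proof.
move=> sx sy sz az0 ZG0 st; rewrite /secular.
apply: ler_ltD; first apply: lerD.
- by apply: ler_wpM2l; [rewrite mulr_ge0 ?sqr_ge0 | exact/ltW/ltr_pinv_sqr].
- by apply: ler_wpM2l; [rewrite mulr_ge0 ?sqr_ge0 | exact/ltW/ltr_pinv_sqr].
- by rewrite ltr_pM2l ?mulr_gt0 ?exprn_gt0 // ltr_pinv_sqr.
Qed.

Lemma secular0 (R : realType) (ax ay az XG YG ZG : R) :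
  ax != 0 -> ay != 0 -> az != 0 ->
  secular ax ay az XG YG ZG 0 =
  XG ^+ 2 / ax ^+ 2 + YG ^+ 2 / ay ^+ 2 + ZG ^+ 2 / az ^+ 2.
Proof. by move=> nx ny nz; rewrite /secular !add0r; field; rewrite nx ny nz. Qed.

Theorem mainTheorem2 (R : realType) (ax ay az XG YG ZG : R)
  (hxy : ay < ax) (hyz : az < ay) (hz : 0 < az)
  (hP : (XG, YG, ZG) <> (0, 0, 0))
  (hX : 0 <= XG) (hY : 0 <= YG) (hZ : 0 < ZG)
  (hin : inside_ellipsoid ax ay az XG YG ZG) :
  exists! t : R, root (polyA ax ay az XG YG ZG) t /\ - az ^+ 2 < t < 0.
Proof.
have ay0 : 0 < ay by lra.
have ax0 : 0 < ax by lra.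
have yz2 : az ^+ 2 < ay ^+ 2 by rewrite ltrXn2r ?nnegrE ?ltW.
have xy2 : ay ^+ 2 < ax ^+ 2 by rewrite ltrXn2r ?nnegrE ?ltW.
have az2 : 0 < az ^+ 2 by rewrite exprn_gt0.
pose p := polyA ax ay az XG YG ZG.
have pos t : - az ^+ 2 < t ->
    [/\ 0 < t + ax ^+ 2, 0 < t + ay ^+ 2 & 0 < t + az ^+ 2].
  by move=> tz; split; lra.
have pl : p.[- az ^+ 2] < 0.
  rewrite horner_polyA addNr expr0n /= !mulr0 !subr0 sub0r oppr_lt0.
  by rewrite !mulr_gt0 ?exprn_gt0 //; lra.
have pr : 0 < p.[0].
  rewrite horner_polyA_secular ?add0r ?expf_neq0 ?gt_eqF //.
  by rewrite secular0 ?gt_eqF // mulr_gt0 ?subr_gt0 // !(mulr_gt0, exprn_gt0).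
have [t /andP[lt tr] rt] : exists2 t, - az ^+ 2 <= t <= 0 & root p t.
  by apply: poly_ivt; rewrite ?oppr_le0 1?ltW // ?(ltW pl) ?(ltW pr).
have tz : - az ^+ 2 < t.
  rewrite lt_neqAle lt andbT; apply: contraTneq rt => <-.
  by rewrite rootE lt_eqF.
have t0 : t < 0.
  rewrite lt_neqAle tr andbT; apply: contraTneq rt => ->.
  by rewrite rootE gt_eqF.
have root1 u : - az ^+ 2 < u -> root p u -> secular ax ay az XG YG ZG u = 1.
  move=> /pos[ux uy uz]; rewrite rootE horner_polyA_secular ?lt0r_neq0 //.
  by rewrite mulf_eq0 gt_eqF ?exprn_gt0 ?mulr_gt0 //= subr_eq0 => /eqP.
have decr u v : - az ^+ 2 < u -> u < v ->
    secular ax ay az XG YG ZG v < secular ax ay az XG YG ZG u.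
  by move=> /pos[ux uy uz]; exact: secular_decreasing.
exists t; split; first by split=> //; rewrite tz t0.
move=> u [ru /andP[uz _]].
case: (ltgtP t u) => // [/(decr _ _ tz)|/(decr _ _ uz)];
  by rewrite !root1 // ltxx.
Qed.
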